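(* Let $G=(\mathcal{N},\mathcal{E},\mathcal{L}^n,\mathcal{L}^e,\mathcal{S},\mathcal{T},n_0)$ be a finite rooted termgraph. There exist a ${}^\star$-free action $\alpha_G$ and a ${}^\star$-free formula $\phi_G$ of the logic of graph modifiers such that for all finite rooted termgraphs $G'=(\mathcal{N}',\mathcal{E}',{\mathcal{L}^n}',{\mathcal{L}^e}',\mathcal{S}',\mathcal{T}',n_0')$: $G'\models\langle\alpha_G\rangle\phi_G$ if and only if there exists a graph homomorphism from $G$ into $G'$.
   Context: **Termgraphs and homomorphisms.** Let $\mathcal{F}$ (edge labels) be a countable set and $\Omega$ (node labels) a countably infinite set. A finite rooted termgraph is a tuple $G=(\mathcal{N},\mathcal{E},\mathcal{L}^n,\mathcal{L}^e,\mathcal{S},\mathcal{T},n_0)$ with a finite set $\mathcal{N}$ of nodes, a finite set $\mathcal{E}$ of edges, a partial function $\mathcal{L}^n:\mathcal{N}\to\Omega$ (nodes where it is undefined are unlabelled), a total function $\mathcal{L}^e:\mathcal{E}\to\mathcal{F}$, source and target functions $\mathcal{S},\mathcal{T}:\mathcal{E}\to\mathcal{N}$, and a root $n_0\in\mathcal{N}$, such that two edges with the same source and the same label are equal. A graph homomorphism $h:G\to G'$ is a pair of functions $h^n:\mathcal{N}\to\mathcal{N}'$, $h^e:\mathcal{E}\to\mathcal{E}'$ such that ${\mathcal{L}^n}'(h^n(m))=\mathcal{L}^n(m)$ for each labelled node $m$ of $G$, and for each edge $f$ of $G$, ${\mathcal{L}^e}'(h^e(f))=\mathcal{L}^e(f)$,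 $\mathcal{S}'(h^e(f))=h^n(\mathcal{S}(f))$ and $\mathcal{T}'(h^e(f))=h^n(\mathcal{T}(f))$. (Unlabelled nodes may be sent to any node; roots need not be preserved.) **Syntax of the logic.** Actions $\alpha,\beta$ and formulas $\phi,\psi$ are defined by mutual recursion: $\alpha ::= a \mid U \mid n \mid \vec{n} \mid \phi? \mid (\omega:=_g\phi) \mid (\omega:=_l\phi) \mid (a+(\phi,\psi)) \mid (a-(\phi,\psi)) \mid (\alpha;\beta) \mid (\alpha\cup\beta) \mid \alpha^\star$, $\phi ::= \omega \mid \bot \mid \neg\phi \mid (\phi\vee\psi) \mid [\alpha]\phi$, with $a\in\mathcal{F}$, $\omega\in\Omega$. Other Boolean connectives are abbreviations, and $\langle\alpha\rangle\phi:=\neg[\alpha]\neg\phi$. ${}^\star$-free means that ${}^\star$ does not occur (at any depth). **Semantics.** Formulas are interpreted in generalized rooted termgraphs, in which the labelling is a map $\mathcal{L}^n:\mathcal{N}\to\mathcal{P}(\Omega)$ (several labels per node allowed) and neither finiteness nor the condition on edges with equal source and label is required; a finite rooted termgraph (whose node labelling is a partial function $\mathcal{L}^n:\mathcal{N}\to\Omega$, so that each node has at most one label) is regarded as a generalized one by replacing the label $\omega$ of a labelled node by $\{\omega\}$ and giving unlabelled nodes the label set $\emptyset$. An edge $(m,a,m')$ means an edge labelled $a$ with source $m$ and target $m'$. Write $G_m$ for $G$ with its root replaced by $m$. $G\models\omega$ iff $\omega\in\mathcal{L}^n(n_0)$; $\bot,\neg,\vee$ as usual; $G\models[\alpha]\phi$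 iff $G'\models\phi$ for all $G'$ with $G\to_\alpha G'$, where (components not mentioned, including the root, are unchanged): - $G\to_a G'$: only the root changes, to some $n_0'$ such that there is an edge $(n_0,a,n_0')$; - $G\to_U G'$: only the root may change, to an arbitrary node; - $G\to_{\phi?}G'$: $G'=G$ and $G\models\phi$; - $G\to_n G'$: a new node with empty label set and no incident edges is added; - $G\to_{\vec{n}}G'$: a new node with empty label set and no incident edges is added, and the root becomes the new node; - $G\to_{\omega:=_g\phi}G'$: for every node $m$, the new label set of $m$ is $\mathcal{L}^n(m)\cup\{\omega\}$ if $G_m\models\phi$ and $\mathcal{L}^n(m)\setminus\{\omega\}$ otherwise; - $G\to_{\omega:=_l\phi}G'$: only the label set of the root $n_0$ changes, to $\mathcal{L}^n(n_0)\cup\{\omega\}$ if $G\models\phi$ and to $\mathcal{L}^n(n_0)\setminus\{\omega\}$ otherwise; - $G\to_{a+(\phi,\psi)}G'$: edges $(m,a,m')$ are added for all $m,m'$ with $G_m\models\phi$ and $G_{m'}\models\psi$; - $G\to_{a-(\phi,\psi)}G'$: all edges $(m,a,m')$ with $G_m\models\phi$ and $G_{m'}\models\psi$ are deleted; - $\to_{\alpha;\beta}$ is relational composition (first $\alpha$, then $\beta$), $\to_{\alpha\cup\beta}$ is union, $\to_{\alpha^\star}$ is the reflexive transitive closure of $\to_\alpha$. *)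

(* Defs.v *)
From HB Require Import structures.
From mathcomp Require Import all_boot.
From mathcomp Require Import boolp classical_sets cardinality.
From Stdlib Require Import Relation_Operators.

Set Implicit Arguments.
Unset Strict Implicit.
Unset Printing Implicit Defensive.

Local Open Scope classical_set_scope.

(* The partial node labelling is option-valued; [None] means "unlabelled". *)
Record termgraph (F Omega : countType) := Termgraph {
  tg_node : finType;
  tg_edge : finType;
  tg_nlabel : tg_node -> option Omega;
  tg_elabel : tg_edge -> F;
  tg_src : tg_edge -> tg_node;
  tg_tgt : tg_edge -> tg_node;
  tg_root : tg_node;
  tg_edge_inj : forall e e' : tg_edge,
    tg_src e = tg_src e' -> tg_elabel e = tg_elabel e' -> e = e' }.

Arguments tg_nlabel {F Omega} t.
Arguments tg_elabel {F Omega} t.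
Arguments tg_src {F Omega} t.
Arguments tg_tgt {F Omega} t.
Arguments tg_root {F Omega} t.

(* Unlabelled nodes of [G] may have any image, and roots need not be preserved. *)
Definition is_graph_hom (F Omega : countType) (G G' : termgraph F Omega)
    (hn : tg_node G -> tg_node G') (he : tg_edge G -> tg_edge G') : Prop :=
  (forall (m : tg_node G) (w : Omega),
     tg_nlabel G m = Some w -> tg_nlabel G' (hn m) = Some w) /\
  (forall f : tg_edge G,
     [/\ tg_elabel G' (he f) = tg_elabel G f,
         tg_src G' (he f) = hn (tg_src G f)
       & tg_tgt G' (he f) = hn (tg_tgt G f)]).

Inductive action (F Omega : Type) : Type :=
| Afollow of F                                       (* a *)
| Ajump                                              (* U *)
| Anew                                               (* n *)
| Anewroot                                           (* \vec{n} *)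
| Atest of formula F Omega                           (* phi? *)
| Agassign of Omega & formula F Omega                (* omega :=_g phi *)
| Alassign of Omega & formula F Omega                (* omega :=_l phi *)
| Aadd of F & formula F Omega & formula F Omega      (* a + (phi, psi) *)
| Adel of F & formula F Omega & formula F Omega      (* a - (phi, psi) *)
| Aseq of action F Omega & action F Omega            (* alpha ; beta *)
| Achoice of action F Omega & action F Omega         (* alpha \cup beta *)
| Astar of action F Omega                            (* alpha^* *)
with formula (F Omega : Type) : Type :=
| Fatom of Omega
| Fbot
| Fneg of formula F Omega
| For of formula F Omega & formula F Omega
| Fbox of action F Omega & formula F Omega.

Arguments Ajump {F Omega}.
Arguments Anew {F Omega}.
Arguments Anewroot {F Omega}.
Arguments Afollow {F Omega}.
Arguments Fatom {F Omega}.
Arguments Fbot {F Omega}.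

Definition Fdia (F Omega : Type) (alpha : action F Omega)
    (phi : formula F Omega) : formula F Omega :=
  Fneg (Fbox alpha (Fneg phi)).

Fixpoint action_star_free (F Omega : Type) (alpha : action F Omega) : bool :=
  match alpha with
  | Afollow _ | Ajump | Anew | Anewroot => true
  | Atest phi | Agassign _ phi | Alassign _ phi => formula_star_free phi
  | Aadd _ phi psi | Adel _ phi psi =>
      formula_star_free phi && formula_star_free psi
  | Aseq beta gamma | Achoice beta gamma =>
      action_star_free beta && action_star_free gamma
  | Astar _ => false
  end
with formula_star_free (F Omega : Type) (phi : formula F Omega) : bool :=
  match phi with
  | Fatom _ | Fbot => true
  | Fneg psi => formula_star_free psi
  | For psi chi => formula_star_free psi && formula_star_free chi
  | Fbox alpha psi => action_star_free alpha && formula_star_free psi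
  end.

Record ggraph (F Omega : Type) := GGraph {
  node : Type;
  edge : Type;
  nlabel : node -> set Omega;
  elabel : edge -> F;
  src : edge -> node;
  tgt : edge -> node;
  root : node }.

Arguments nlabel {F Omega} g.
Arguments elabel {F Omega} g.
Arguments src {F Omega} g.
Arguments tgt {F Omega} g.
Arguments root {F Omega} g.

Definition ggraph_of (F Omega : countType) (G : termgraph F Omega) :
    ggraph F Omega :=
  @GGraph F Omega (tg_node G) (tg_edge G)
    (fun m => [set w | tg_nlabel G m = Some w])
    (tg_elabel G) (tg_src G) (tg_tgt G) (tg_root G).

Definition reroot (F Omega : Type) (G : ggraph F Omega) (m : node G) :
    ggraph F Omega :=
  @GGraph F Omega (node G) (edge G)
    (nlabel G) (elabel G) (src G) (tgt G) m.

Definition relabel (F Omega : Type) (G : ggraph F Omega)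
    (L : node G -> set Omega) : ggraph F Omega :=
  @GGraph F Omega (node G) (edge G)
    L (elabel G) (src G) (tgt G) (root G).

(* The new node is [None]; the old ones are embedded by [Some]. *)
Definition add_node (F Omega : Type) (G : ggraph F Omega) : ggraph F Omega :=
  @GGraph F Omega (option (node G)) (edge G)
    (fun m => if m is Some m' then nlabel G m' else set0)
    (elabel G) (fun e => Some (src G e)) (fun e => Some (tgt G e))
    (Some (root G)).

Definition add_node_root (F Omega : Type) (G : ggraph F Omega) :
    ggraph F Omega :=
  @reroot F Omega (add_node G) None.

(* One fresh [a]-edge is added for each pair in [P] x [Q], in parallel to those
   that may already be there; formulas cannot distinguish parallel edges. *)
Definition add_edges (F Omega : Type) (G : ggraph F Omega) (a : F)
    (P Q : set (node G)) : ggraph F Omega :=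
  @GGraph F Omega (node G)
    (edge G + {p : node G * node G | P p.1 /\ Q p.2})
    (nlabel G)
    (fun e => match e with inl e' => elabel G e' | inr _ => a end)
    (fun e => match e with inl e' => src G e' | inr p => (sval p).1 end)
    (fun e => match e with inl e' => tgt G e' | inr p => (sval p).2 end)
    (root G).

Definition del_edges (F Omega : Type) (G : ggraph F Omega) (a : F)
    (P Q : set (node G)) : ggraph F Omega :=
  @GGraph F Omega (node G)
    {e : edge G | ~ [/\ elabel G e = a, P (src G e) & Q (tgt G e)]}
    (nlabel G)
    (fun e => elabel G (sval e))
    (fun e => src G (sval e))
    (fun e => tgt G (sval e))
    (root G).

Definition set_label (Omega : Type) (w : Omega) (P : Prop) (A : set Omega) :
    set Omega :=
  if `[< P >] then A `|` [set w] else A `\` [set w].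

Fixpoint sat (F Omega : Type) (phi : formula F Omega) (G : ggraph F Omega)
    {struct phi} : Prop :=
  match phi with
  | Fatom w => nlabel G (root G) w
  | Fbot => False
  | Fneg psi => ~ sat psi G
  | For psi chi => sat psi G \/ sat chi G
  | Fbox alpha psi => forall G', step alpha G G' -> sat psi G'
  end
with step (F Omega : Type) (alpha : action F Omega) (G G' : ggraph F Omega)
    {struct alpha} : Prop :=
  match alpha with
  | Afollow a =>
      exists e : edge G,
        [/\ elabel G e = a, src G e = root G & G' = reroot (tgt G e)]
  | Ajump => exists m : node G, G' = reroot m
  | Anew => G' = add_node G
  | Anewroot => G' = add_node_root G
  | Atest phi => G' = G /\ sat phi G
  | Agassign w phi =>
      G' = relabel (fun m : node G =>
             set_label w (sat phi (reroot m)) (nlabel G m))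
  | Alassign w phi =>
      (* node equality on a bare [Type] is decided classically *)
      G' = relabel (fun m : node G =>
             if `[< m = root G >] then set_label w (sat phi G) (nlabel G m)
             else nlabel G m)
  | Aadd a phi psi =>
      G' = add_edges a [set m : node G | sat phi (reroot m)]
                       [set m : node G | sat psi (reroot m)]
  | Adel a phi psi =>
      G' = del_edges a [set m : node G | sat phi (reroot m)]
                       [set m : node G | sat psi (reroot m)]
  | Aseq beta gamma => exists2 H, step beta G H & step gamma H G'
  | Achoice beta gamma => step beta G G' \/ step gamma G G'
  | Astar beta => clos_refl_trans (ggraph F Omega) (step beta) G G'
  end.

(* Main.v *)
Require Import Defs.
From mathcomp Require Import all_boot.
From mathcomp Require Import boolp classical_sets cardinality functions.

Local Open Scope classical_set_scope.

(** Since [Omega] is infinite, every node [n] of [G] can be given its own label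
    [p n] that does not occur in [G].  The action erases each [p n] from [G'] and
    then puts it on a single, arbitrarily chosen node: the graphs it reaches
    correspond to the maps from the nodes of [G] to those of [G'].  With the image
    of [n] identified by [p n], a formula can say that every node label and every
    edge of [G] is preserved.  [G'] may itself use the labels [p n], whence the
    erasure, which is harmless because [G] does not use them. *)

Definition Ftop {F Omega : Type} : formula F Omega := Fneg Fbot.

Definition Fand {F Omega : Type} (phi psi : formula F Omega) : formula F Omega :=
  Fneg (For (Fneg phi) (Fneg psi)).

Definition Fall {F Omega T : Type} (f : T -> formula F Omega) (s : seq T) :
    formula F Omega :=
  foldr (fun x phi => Fand (f x) phi) Ftop s.

Lemma sat_dia {F Omega : Type} (a : action F Omega) phi (K : ggraph F Omega) :
  sat (Fdia a phi) K <-> exists2 H, step a K H & sat phi H.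
Proof.
split=> /= [nbox | [H KH Hphi] nphi]; last exact: nphi KH Hphi.
by apply: contrapT => nH; apply: nbox => H KH Hphi; apply: nH; exists H.
Qed.

Lemma sat_dia_jump {F Omega : Type} phi (K : ggraph F Omega) :
  sat (Fdia Ajump phi) K <-> exists m : node K, sat phi (reroot m).
Proof.
rewrite sat_dia; split=> [[_ [m ->]]|[m Hm]]; first by exists m.
by exists (reroot m); first exists m.
Qed.

Lemma sat_dia_follow {F Omega : Type} (a : F) phi (K : ggraph F Omega) :
  sat (Fdia (Afollow a) phi) K <->
  exists e : edge K,
    [/\ elabel K e = a, src K e = Defs.root K & sat phi (reroot (tgt K e))].
Proof.
rewrite sat_dia; split=> [[_ [e [ea er ->]]]|[e [ea er Hm]]]; first by exists e.
by exists (reroot (tgt K e)); first exists e.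
Qed.

Lemma sat_and {F Omega : Type} (phi psi : formula F Omega) (K : ggraph F Omega) :
  sat (Fand phi psi) K <-> sat phi K /\ sat psi K.
Proof.
split=> /= [nor|[Hphi Hpsi] []//].
by split; apply: contrapT => H; apply: nor; [left|right].
Qed.

Lemma sat_all {F Omega : Type} {T : eqType} (f : T -> formula F Omega) (s : seq T)
    (K : ggraph F Omega) :
  sat (Fall f s) K <-> forall x, x \in s -> sat (f x) K.
Proof.
elim: s => [|y s IHs]; first by split=> // _ [].
rewrite [Fall _ _]/(Fand (f y) (Fall f s)) sat_and IHs; split=> [[Hy Hs] x|H].
  by rewrite in_cons => /predU1P[->|/Hs].
by split=> [|x xs]; apply: H; rewrite in_cons ?eqxx ?xs ?orbT.
Qed.

Lemma Fall_star_free {F Omega T : Type} (f : T -> formula F Omega) (s : seq T) :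
  (forall x, formula_star_free (f x)) -> formula_star_free (Fall f s).
Proof. by move=> Hf; elim: s => //= x s ->; rewrite Hf. Qed.

Definition mark_one {F Omega : Type} (w : Omega) : action F Omega :=
  Aseq (Agassign w Fbot) (Aseq Ajump (Alassign w Ftop)).

(** The closing [Ajump] leaves the root arbitrary, so the graphs reached have the same form for
    every [s], the empty list included. *)
Definition mark {F Omega : Type} (s : seq Omega) : action F Omega :=
  foldr (fun w a => Aseq (mark_one w) a) Ajump s.

(** Marking keeps the nodes and edges of [K]. With [K] fixed, [reroot] and [relabel] of such a graph
    are again of this form by computation, so all labellings live on the one type [node K]. *)
Definition with_labels {F Omega : Type} (K : ggraph F Omega)
    (L : node K -> set Omega) (r : node K) : ggraph F Omega :=
  @GGraph F Omega (node K) (edge K) L (elabel K) (src K) (tgt K) r.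
Arguments with_labels {F Omega} K L r.

(** The argument of [h] is a label, so that induction can run over any list [s] of labels,
    repetitions allowed. *)
Definition marked {Omega : eqType} {N : Type} (L : N -> set Omega)
    (h : Omega -> N) (s : seq Omega) : N -> set Omega :=
  fun x => [set v | if v \in s then x = h v else L x v].

Lemma mark_star_free {F Omega : Type} (s : seq Omega) :
  action_star_free (@mark F Omega s).
Proof. by elim: s. Qed.

Lemma set_labelE {Omega : Type} (w : Omega) (P : Prop) (A : set Omega) (v : Omega) :
  set_label w P A v <-> (v = w /\ P) \/ (v <> w /\ A v).
Proof.
rewrite /set_label; case: asboolP => HP; rewrite /setU /setD /=;
  have := EM (v = w); tauto.
Qed.

Lemma step_mark_one {F : Type} {Omega : eqType} (K : ggraph F Omega) (w : Omega)
    (L : node K -> set Omega) (r : node K) (H : ggraph F Omega) :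
  step (mark_one w) (with_labels K L r) H <->
  exists m, H = with_labels K (marked L (fun=> m) [:: w]) m.
Proof.
(* The left side is the labelling that the three steps compute; [~ False] is the meaning of
   [Ftop]. *)
have E m : (fun x : node K =>
    if `[< x = m >] then
      set_label w (~ False) (set_label w False (L x))
    else set_label w False (L x)) = marked L (fun=> m) [:: w].
  apply/funext => x; apply/seteqP.
  split=> v; rewrite /marked /= inE; case: asboolP => xm;
    rewrite !set_labelE; case: eqP => vw; tauto.
split=> [[_ -> [_ [m ->] ->]]|[m ->]].
  by exists m; rewrite -E.
eexists; first by [].
exists (with_labels K (fun x => set_label w False (L x)) m); first by exists m.
by rewrite -E.
Qed.

Lemma step_mark {F : Type} {Omega : eqType} (K : ggraph F Omega) (s : seq Omega)
    (L : node K -> set Omega) (r : node K) (H : ggraph F Omega) :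
  step (mark s) (with_labels K L r) H <->
  exists h r', H = with_labels K (marked L h s) r'.
Proof.
elim: s L r H => [|w s IHs] L r H.
  split=> [[m ->]|[h [m ->]]]; last by exists m.
  by exists (fun=> m), m.
(* If [w] recurs in [s], the later marking erases the earlier one, so [m] counts only when [w] is
   not in [s]. *)
have E h m : marked (marked L (fun=> m) [:: w]) h s =
    marked L (fun v => if v \in s then h v else m) (w :: s).
  apply/funext => x; apply/seteqP; split=> v; rewrite /marked /= !inE;
    by case: (v \in s); rewrite ?orbT ?orbF.
split=> [[_ /step_mark_one[m ->] /IHs[h [r' ->]]]|[h [r' ->]]].
  by rewrite E; do 2 eexists.
(* The node [h w] is right in either case: a recurrence of [w] in [s] puts the label there again. *)
exists (with_labels K (marked L (fun=> h w) [:: w]) (h w)).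
  by apply/step_mark_one; exists (h w).
apply/IHs; exists h, r'; rewrite E; congr with_labels.
apply/funext => x; apply/seteqP; split=> v; rewrite /marked /= inE;
  by case: (v \in s); rewrite ?orbT ?orbF //; case: eqP => [->|].
Qed.

(** The complement of a finite set in an infinite type is infinite, so [nat] injects into it;
    [enum_rank] injects [T] into [nat]. *)
Lemma fresh_labels {Omega : countType} (T : finType) (A : set Omega) :
  infinite_set [set: Omega] -> finite_set A ->
  exists p : T -> Omega, injective p /\ forall x, ~ A (p x).
Proof.
move=> Oinf Afin.
have /infiniteP/card_leP[f] : infinite_set ([set: Omega] `\` A).
  exact: infinite_setD.
exists (fun x => val (f (to_setT (enum_rank x : nat)))).
split=> [x y /val_inj/inj fxy|x].
  apply/enum_rank_inj/val_inj.
  by apply: (congr1 val (fxy _ _)); rewrite inE.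
by have /set_mem[] := valP (f (to_setT (enum_rank x : nat))).
Qed.

Section HomFormula.
Context {F Omega : countType} (G : termgraph F Omega) (p : tg_node G -> Omega).

Definition node_formula (n : tg_node G) : formula F Omega :=
  if tg_nlabel G n is Some w then Fdia Ajump (Fand (Fatom (p n)) (Fatom w))
  else Ftop.

Definition edge_formula (f : tg_edge G) : formula F Omega :=
  Fdia Ajump (Fand (Fatom (p (tg_src G f)))
    (Fdia (Afollow (tg_elabel G f)) (Fatom (p (tg_tgt G f))))).

Definition hom_formula : formula F Omega :=
  Fand (Fall node_formula (enum (tg_node G)))
       (Fall edge_formula (enum (tg_edge G))).

Lemma hom_formula_star_free : formula_star_free hom_formula.
Proof.
rewrite /= !Fall_star_free // => n.
by rewrite /node_formula; case: tg_nlabel.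
Qed.

(** A jump to a node carrying [p n] can only end at [hn n], so each conjunct states the homomorphism
    condition at one node or edge. Each conjunct is [Ftop] or begins with a jump, which is why [r]
    is arbitrary. *)
Lemma sat_hom_formula (G' : termgraph F Omega)
    (L : tg_node G' -> set Omega) (r : tg_node G') (hn : tg_node G -> tg_node G') :
  (forall n x, L x (p n) <-> x = hn n) ->
  (forall n w, tg_nlabel G n = Some w ->
     forall x, L x w <-> tg_nlabel G' x = Some w) ->
  sat hom_formula (with_labels (ggraph_of G') L r) <->
  exists he : tg_edge G -> tg_edge G', is_graph_hom hn he.
Proof.
move=> Lp Lw; rewrite sat_and !sat_all; split.
  move=> [Hn He].
  (* Each edge formula provides an image for its own edge; choice collects these into [he]. *)
  have /choice[he Hhe] f : exists e : tg_edge G',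
      [/\ tg_elabel G' e = tg_elabel G f, tg_src G' e = hn (tg_src G f)
        & tg_tgt G' e = hn (tg_tgt G f)].
    have /sat_dia_jump[x /sat_and[xf /sat_dia_follow[e [el es et]]]] :=
      He f (mem_enum _ f).
    by exists e; split; [exact: el|rewrite -((Lp _ _).1 xf)|apply/Lp].
  exists he; split=> [n w nw|//].
  have := Hn n (mem_enum _ n).
  rewrite /node_formula nw => /sat_dia_jump[x /sat_and[xn xw]].
  by rewrite -((Lp _ _).1 xn); apply/(Lw _ _ nw).
move=> [he [Hn He]]; split=> [n _|f _].
  rewrite /node_formula; case nw: tg_nlabel => [w|]; last by case.
  apply/sat_dia_jump; exists (hn n); apply/sat_and; split; first exact/Lp.
  by apply/(Lw _ _ nw); exact: Hn.
have [el es et] := He f.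
apply/sat_dia_jump; exists (hn (tg_src G f)); apply/sat_and.
split; first exact/Lp.
by apply/sat_dia_follow; exists (he f); split=> //; apply/Lp.
Qed.

End HomFormula.

Theorem proposition4p1 (F Omega : countType)
    (Omega_infinite : infinite_set [set: Omega]) (G : termgraph F Omega) :
  exists (alphaG : action F Omega) (phiG : formula F Omega),
    [/\ action_star_free alphaG, formula_star_free phiG
      & forall G' : termgraph F Omega,
          sat (Fdia alphaG phiG) (ggraph_of G') <->
          exists (hn : tg_node G -> tg_node G')
                 (he : tg_edge G -> tg_edge G'), is_graph_hom hn he].
Proof.
pose used : set Omega := [set w | w \in pmap (tg_nlabel G) (enum (tg_node G))].
have [|p [p_inj p_fresh]] := @fresh_labels Omega (tg_node G) used Omega_infinite.
  exact: finite_seq.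
pose s := [seq p n | n <- enum (tg_node G)].
have ps n : p n \in s by apply: map_f; rewrite mem_enum.
have ws n w : tg_nlabel G n = Some w -> w \notin s.
  move=> nw; apply/negP => /mapP[k _ wk]; apply: (p_fresh k).
  by rewrite -wk /used /= mem_pmap -nw map_f // mem_enum.
(* The formula sees [h] only through its values at the labels [p n]; the labels of [G] lie outside
   [s], so marking leaves them in place. *)
have sat_marked G' (h : Omega -> tg_node G') r hn :
    (forall n, h (p n) = hn n) ->
    sat (hom_formula G p)
      (with_labels (ggraph_of G') (marked (nlabel (ggraph_of G')) h s) r) <->
    exists he : tg_edge G -> tg_edge G', is_graph_hom hn he.
  move=> hp; apply: sat_hom_formula => [n x|n w /ws wNs x].
    by rewrite /marked /= ps hp.
  by rewrite /marked /= (negbTE wNs).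
exists (mark s), (hom_formula G p); split=> [||G'].
- exact: mark_star_free.
- exact: hom_formula_star_free.
(* By computation, [ggraph_of G'] is [with_labels] applied to its own labelling and root. *)
have step_G' H := step_mark (ggraph_of G') s (nlabel _) (tg_root G') H.
rewrite sat_dia; split=> [[_ /step_G'[h [r ->]] Hr]|[hn hom]].
  by exists (h \o p); apply/(sat_marked _ h r).
(* Here [h] inverts [p] and applies [hn]; the root is the default value at labels outside [s]. *)
pose h v := if [pick n | p n == v] is Some n then hn n else tg_root G'.
have hp n : h (p n) = hn n.
  rewrite /h; case: pickP => [k /eqP/p_inj -> //|/(_ n)].
  by rewrite eqxx.
exists (with_labels (ggraph_of G') (marked (nlabel (ggraph_of G')) h s)
  (tg_root G')); last exact/(sat_marked _ h _ hn).
by apply/step_G'; exists h, (tg_root G').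
Qed.
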